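(* Let $(A_n)_{n\ge1},(B_n)_{n\ge1},(C_n)_{n\ge1},(D_n)_{n\ge1},(E_n)_{n\ge1}$ be the sequences associated with the anti-Teranacci sequence $(E_n)$. Then for all $n\ge 1$: $$0\le 17n-11-4A_n\le 4,$$ $$0\le 17n-7-4B_n\le 4,$$ $$0\le 17n-3-4C_n\le 4,$$ $$0\le 17n+1-4D_n\le 3,$$ $$0\le 17n-5-E_n\le 3.$$
   Context: For a set $S$ of positive integers, $\mathrm{mex}(S)$ denotes the smallest positive integer not in $S$. The sequences are defined recursively as follows: $A_1=1$, $B_1=2$, $C_1=3$, $D_1=4$, $E_1=10$, and for $n\ge 1$, with $S_n=\{A_i,B_i,C_i,D_i,E_i: 1\le i\le n\}$, one sets $A_{n+1}=\mathrm{mex}(S_n)$, $B_{n+1}=\mathrm{mex}(S_n\cup\{A_{n+1}\})$, $C_{n+1}=\mathrm{mex}(S_n\cup\{A_{n+1},B_{n+1}\})$, $D_{n+1}=\mathrm{mex}(S_n\cup\{A_{n+1},B_{n+1},C_{n+1}\})$, and $E_{n+1}=A_{n+1}+B_{n+1}+C_{n+1}+D_{n+1}$. The $E_n$ are the anti-Teranacci numbers (OEIS A299409). *)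

(* Defs.v *)
From mathcomp Require Import all_boot.

Set Implicit Arguments.
Unset Strict Implicit.
Unset Printing Implicit Defensive.

Lemma mex_subproof (s : seq nat) : exists m, (0 < m) && (m \notin s).
Proof.
exists (\max_(i <- s) i).+1; rewrite ltn0Sn /=; apply/negP => s_m.
by have := @leq_bigmax_seq _ s xpredT id _ s_m isT; rewrite ltnn.
Qed.

(* A finite set of positive integers is given by any sequence enumerating it;
   only membership matters, so repetitions and order are irrelevant. *)
Definition mex (s : seq nat) : nat := ex_minn (mex_subproof s).

Definition terms_upto (A B C D E : nat -> nat) (n : nat) : seq nat :=
  flatten [seq [:: A i; B i; C i; D i; E i] | i <- iota 1 n].

(* Sequences are indexed from 1; the values at index 0 are unconstrained. *)
Record anti_teranacci (A B C D E : nat -> nat) : Prop := AntiTeranacci {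
  anti_teranacci_A1 : A 1 = 1;
  anti_teranacci_B1 : B 1 = 2;
  anti_teranacci_C1 : C 1 = 3;
  anti_teranacci_D1 : D 1 = 4;
  anti_teranacci_E1 : E 1 = 10;
  anti_teranacci_AS : forall n, 1 <= n ->
    A n.+1 = mex (terms_upto A B C D E n);
  anti_teranacci_BS : forall n, 1 <= n ->
    B n.+1 = mex (A n.+1 :: terms_upto A B C D E n);
  anti_teranacci_CS : forall n, 1 <= n ->
    C n.+1 = mex [:: A n.+1, B n.+1 & terms_upto A B C D E n];
  anti_teranacci_DS : forall n, 1 <= n ->
    D n.+1 = mex [:: A n.+1, B n.+1, C n.+1 & terms_upto A B C D E n];
  anti_teranacci_ES : forall n, 1 <= n ->
    E n.+1 = A n.+1 + B n.+1 + C n.+1 + D n.+1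
}.

(* Witness that the recursion is satisfiable: [rows n] lists the first n rows
   [:: A i; B i; C i; D i; E i], oldest first. *)
Definition next_row (s : seq nat) : seq nat :=
  let a := mex s in
  let b := mex (a :: s) in
  let c := mex [:: a, b & s] in
  let d := mex [:: a, b, c & s] in
  [:: a; b; c; d; a + b + c + d].

Fixpoint rows (n : nat) : seq (seq nat) :=
  if n isn't n'.+1 then [::] else
  if n' is 0 then [:: [:: 1; 2; 3; 4; 10]] else
  rcons (rows n') (next_row (flatten (rows n'))).

Lemma anti_teranacci_exists :
  exists A B C D E : nat -> nat, anti_teranacci A B C D E.
Proof.
pose F k n := nth 0 (last [::] (rows n)) k.
exists (F 0), (F 1), (F 2), (F 3), (F 4).
have FS n : 0 < n -> last [::] (rows n.+1) = next_row (flatten (rows n)).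
  by case: n => // n _; rewrite [rows _.+2]/= last_rcons.
have rowE n : 0 < n ->
    last [::] (rows n) = [:: F 0 n; F 1 n; F 2 n; F 3 n; F 4 n].
  by case: n => // -[|n] _ //; rewrite /F FS.
have rowsS n : rows n.+1 = rcons (rows n) (last [::] (rows n.+1)).
  by case: n => // n; rewrite FS.
have S_n n : terms_upto (F 0) (F 1) (F 2) (F 3) (F 4) n = flatten (rows n).
  elim: n => // n IHn; rewrite rowsS rowE // flatten_rcons -IHn.
  by rewrite /terms_upto -(addn1 n) iotaD map_cat flatten_cat addn1.
by split=> // n n_gt0; rewrite ?S_n /F FS.
Qed.

(* Main.v *)
(** The terms of row [n.+1] other than [E n.+1] are the first four integers
    above [D n] that avoid the values [E k].  The bounds are proved together by
    strong induction: those on [E] put [E k] in [[17k - 8, 17k - 5]], and those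
    on [D] determine [D n].  Hence the next four candidates meet some [E k] only
    if [n.+1 = 4q + 3], in which case row [n.+1] is [[17q + 9, 17q + 13]] with
    [E q.+1] removed.  In every case the resulting bounds on [A], [B], [C], [D]
    imply the one on their sum [E n.+1]. *)

Require Import Defs.
From mathcomp Require Import all_boot all_order all_algebra.
From mathcomp Require Import zify.
Import Order.TTheory GRing.Theory Num.Theory.

Lemma mex_gt0 (s : seq nat) : 0 < mex s.
Proof. by rewrite /mex; case: ex_minnP => m /andP[]. Qed.

Lemma mex_notin (s : seq nat) : mex s \notin s.
Proof. by rewrite /mex; case: ex_minnP => m /andP[]. Qed.

Lemma mex_le {s : seq nat} {m : nat} : 0 < m -> m \notin s -> mex s <= m.
Proof.
by move=> m_gt0 sm; rewrite /mex; case: ex_minnP => k _; apply; rewrite m_gt0.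
Qed.

Lemma lt_mex {s : seq nat} {m : nat} : 0 < m -> m < mex s -> m \in s.
Proof.
by move=> m_gt0; apply: contraLR => /(mex_le m_gt0); rewrite -leqNgt.
Qed.

(** If [d.+1 < a] then [d.+1 = e]; if also [d.+2 < a], then [e] would equal both. So at most the
    single value [e] is skipped. *)
Lemma next_avoiding (d a e : nat) : d < a -> e != a ->
  (forall v, d < v <= d.+2 -> v < a -> v = e) -> a = d.+1 + (e == d.+1).
Proof.
by move=> lt_da e_a gap; have := gap d.+1; have := gap d.+2; lia.
Qed.

Lemma terms_uptoS (A B C D E : nat -> nat) (n : nat) :
  terms_upto A B C D E n.+1 = terms_upto A B C D E n
    ++ [:: A n.+1; B n.+1; C n.+1; D n.+1; E n.+1].
Proof.
by rewrite /terms_upto -(addn1 n) iotaD map_cat flatten_cat add1n addn1.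
Qed.

Section Rows.

Context (A B C D E : nat -> nat) (hABCDE : anti_teranacci A B C D E).

Let S := terms_upto A B C D E.

Lemma mem_E (n k : nat) : 1 <= k <= n -> E k \in S n.
Proof.
move=> k_n; apply/flatten_mapP; exists k; last by rewrite !inE eqxx !orbT.
by rewrite mem_iota add1n ltnS.
Qed.

(** Past the first row, [D n] is a mex of terms that all enter [S n], so everything positive below
    it is already used. *)
Lemma mem_terms_upto_le (n v : nat) : 1 <= n -> 0 < v <= D n -> v \in S n.
Proof.
case: hABCDE => A1 B1 C1 D1 _ _ _ _ DS _.
elim: n => // -[_ _|n IHn _].
  by rewrite /S /terms_upto /= A1 B1 C1 D1 !inE; lia.
rewrite DS // => /andP[v_gt0]; rewrite leq_eqVlt => /orP[/eqP->|/(lt_mex v_gt0)].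
  by rewrite -DS // /S terms_uptoS mem_cat !inE eqxx !orbT.
rewrite /S [in X in _ -> X]terms_uptoS mem_cat !inE.
by case/or4P => ->; rewrite ?orbT.
Qed.

(** Along a row the mex is taken of growing sets, each containing the preceding term, so it strictly
    increases. [A n.+1] passes [D n] because [S n] exhausts the integers from 1 to [D n]. *)
Lemma lt_row (n : nat) : 1 <= n ->
  [/\ D n < A n.+1, A n.+1 < B n.+1, B n.+1 < C n.+1 & C n.+1 < D n.+1].
Proof.
move=> n_gt0; case: (hABCDE) => _ _ _ _ _ AS BS CS DS _.
have nA := mex_notin (S n); rewrite -AS // in nA.
have nB := mex_notin (A n.+1 :: S n); rewrite -BS // in nB.
have nC := mex_notin [:: A n.+1, B n.+1 & S n]; rewrite -CS // in nC.
have nD := mex_notin [:: A n.+1, B n.+1, C n.+1 & S n]; rewrite -DS // in nD.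
have B0 : 0 < B n.+1 by rewrite BS ?mex_gt0.
have C0 : 0 < C n.+1 by rewrite CS ?mex_gt0.
have D0 : 0 < D n.+1 by rewrite DS ?mex_gt0.
rewrite !inE !negb_or in nB nC nD.
case/andP: nB => BA nB; case/and3P: nC => CA CB nC.
case/and4P: nD => DA DB DC nD.
split.
- rewrite ltnNge; apply: contra nA => A_le.
  by apply: mem_terms_upto_le; rewrite // A_le AS // mex_gt0.
- by rewrite ltn_neqAle eq_sym BA /= AS // mex_le.
- by rewrite ltn_neqAle eq_sym CB /= BS // mex_le // inE negb_or CA.
- by rewrite ltn_neqAle eq_sym DC /= CS // mex_le // !inE !negb_or DA DB.
Qed.

(** By [lt_row], the other four columns stay at or below [D n] through row [n]. *)
Lemma mem_terms_upto_gt (n v : nat) : 1 <= n -> D n < v -> v \in S n ->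
  exists2 k, 1 <= k <= n & v = E k.
Proof.
elim: n => // -[_ _|n IHn _ Dv].
  case: hABCDE => A1 B1 C1 D1 E1 _ _ _ _ _.
  rewrite /S /terms_upto /= A1 B1 C1 D1 E1 !inE => Dv v_S.
  by exists 1; rewrite // E1; lia.
have [DA AB BC CD] := lt_row n.+1 isT.
rewrite /S terms_uptoS mem_cat !inE => /orP[|vE]; last by exists n.+2; lia.
by case/IHn=> [//||k k_n ->]; [lia | exists k; lia].
Qed.

Lemma E_neq_row (n k : nat) : 1 <= k <= n ->
  E k \notin [:: A n.+1; B n.+1; C n.+1; D n.+1].
Proof.
move=> k_n; have n_gt0 : 1 <= n by lia.
have := mem_E n k k_n; apply: contraL.
case: hABCDE => _ _ _ _ _ AS BS CS DS _.
rewrite !inE => /or4P[] /eqP->.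
- by rewrite AS ?mex_notin.
- have := mex_notin (A n.+1 :: S n).
  by rewrite -BS // !inE !negb_or => /andP[].
- have := mex_notin [:: A n.+1, B n.+1 & S n].
  by rewrite -CS // !inE !negb_or => /and3P[].
- have := mex_notin [:: A n.+1, B n.+1, C n.+1 & S n].
  by rewrite -DS // !inE !negb_or => /and4P[].
Qed.

Lemma row_gap (n v : nat) : 1 <= n -> D n < v < D n.+1 ->
  v \in [:: A n.+1; B n.+1; C n.+1] \/ exists2 k, 1 <= k <= n & v = E k.
Proof.
move=> n_gt0 /andP[Dv vD].
have : v \in [:: A n.+1; B n.+1; C n.+1] ++ S n.
  apply: lt_mex; first by lia.
  by case: hABCDE => _ _ _ _ _ _ _ _ <-.
rewrite mem_cat => /orP[]; first by left.
by move=> v_S; right; apply: mem_terms_upto_gt.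
Qed.

(** The inequalities to be proved, with subtractions moved across so that they can be stated in
    [nat]. *)
Let bounds n := [/\ 4 * A n + 11 <= 17 * n <= 4 * A n + 15,
  4 * B n + 7 <= 17 * n <= 4 * B n + 11,
  4 * C n + 3 <= 17 * n <= 4 * C n + 7,
  4 * D n <= 17 * n + 1 <= 4 * D n + 3
& E n + 5 <= 17 * n <= E n + 8].

Lemma row_bounds (n : nat) : 1 <= n -> bounds n.
Proof.
have [m] := ubnP n; elim: m n => // m IHm [//|[_ _|n]].
  by case: hABCDE => A1 B1 C1 D1 E1 _ _ _ _ _; split; lia.
move Dp : n.+1 => p /ltnSE lt_pm _.
have p_gt0 : 0 < p by lia.
have [DA AB BC CD] := lt_row p p_gt0.
have [_ _ _ Dp_bd _] := IHm p lt_pm p_gt0.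
(* Since [E k] lies in [[17k - 8, 17k - 5]], its residue modulo 17 is between 9 and 12, and it
   determines [k]. *)
have gap v : D p < v < D p.+1 -> v \in [:: A p.+1; B p.+1; C p.+1]
    \/ 9 <= v %% 17 <= 12 /\ v = E ((v + 8) %/ 17).
  case/(row_gap p v p_gt0) => [|[k k_p v_E]]; [by left | right].
  have [||_ _ _ _ E_bd] := IHm k; [lia | lia |].
  have <- : k = (v + 8) %/ 17 by lia.
  by split=> //; lia.
have ES : E p.+1 = A p.+1 + B p.+1 + C p.+1 + D p.+1.
  by case: hABCDE => _ _ _ _ _ _ _ _ _; apply.
have [p2 | p_n2] := eqVneq (p %% 4) 2.
  (* The bounds say that [D p] is the floor of [(17p + 1) / 4]; here [p = 4q + 2]. *)
  pose q := p %/ 4; have Dq : D p = 17 * q + 8 by lia.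
  have [||_ _ _ _ E_bd] := IHm q.+1; [lia | lia |].
  have q_p : 1 <= q.+1 <= p by lia.
  have := E_neq_row p q.+1 q_p; rewrite !inE !negb_or => /and4P[EA EB EC ED].
  (* Each of the next terms advances by at most 2, so the values tested below, up to [(C p.+1).+2],
     stay within [D p + 8]. In this window only [E q.+1] can occur. *)
  have gapE v : D p < v <= D p + 9 -> v < D p.+1 ->
      v \in [:: A p.+1; B p.+1; C p.+1; E q.+1].
    move=> v_bd lt_v; have [||[_ ->]] := gap v; first by lia.
      by rewrite !inE => /or3P[] ->; rewrite ?orbT.
    have -> : (v + 8) %/ 17 = q.+1 by lia.
    by rewrite !inE eqxx !orbT.
  clear gap IHm; move: (E q.+1) => e in E_bd EA EB EC ED gapE.
  have A' : A p.+1 = (D p).+1 + (e == (D p).+1).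
    apply: next_avoiding => // v *; have := gapE v; rewrite !inE; lia.
  have B' : B p.+1 = (A p.+1).+1 + (e == (A p.+1).+1).
    apply: next_avoiding => // v *; have := gapE v; rewrite !inE; lia.
  have C' : C p.+1 = (B p.+1).+1 + (e == (B p.+1).+1).
    apply: next_avoiding => // v *; have := gapE v; rewrite !inE; lia.
  have D' : D p.+1 = (C p.+1).+1 + (e == (C p.+1).+1).
    apply: next_avoiding => // v *; have := gapE v; rewrite !inE; lia.
  (* The row sums to [85q + 55 - e] with [e] in [[17q + 9, 17q + 12]], which gives exactly the range
     required of [E p.+1]. *)
  by split; lia.
(* For [p] congruent to 0, 1, 3 modulo 4, [D p] is 0, 4, 13 modulo 17, so the next four integers
   miss the residues 9 to 12. *)
have gapE v : D p < v <= D p + 4 -> v < D p.+1 ->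
    v \in [:: A p.+1; B p.+1; C p.+1].
  by move=> v_bd lt_v; have [||[]] := gap v; lia.
clear gap IHm.
have A' : A p.+1 = (D p).+1.
  have := gapE (D p).+1; rewrite !inE; lia.
have B' : B p.+1 = (A p.+1).+1.
  have := gapE (A p.+1).+1; rewrite !inE; lia.
have C' : C p.+1 = (B p.+1).+1.
  have := gapE (B p.+1).+1; rewrite !inE; lia.
have D' : D p.+1 = (C p.+1).+1.
  have := gapE (C p.+1).+1; rewrite !inE; lia.
by split; lia.
Qed.

End Rows.

Local Open Scope ring_scope.

Theorem mainTheorem6 (A B C D E : nat -> nat)
    (hABCDE : anti_teranacci A B C D E) (n : nat) (hn : (1 <= n)%N) :
  [/\ 0 <= 17 * n%:Z - 11 - 4 * (A n)%:Z <= 4,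
      0 <= 17 * n%:Z - 7 - 4 * (B n)%:Z <= 4,
      0 <= 17 * n%:Z - 3 - 4 * (C n)%:Z <= 4,
      0 <= 17 * n%:Z + 1 - 4 * (D n)%:Z <= 3
    & 0 <= 17 * n%:Z - 5 - (E n)%:Z <= 3].
Proof.
by have [] := row_bounds A B C D E hABCDE n hn; split; lia.
Qed.
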